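(* Let $0<m<n$, $s:=n-m$, and let $Z\subseteq\mathbb{P}^n$ be an $m$-dimensional irreducible complex projective variety. Let $L\in\mathbb{G}(s,\mathbb{P}^n)$ be given as the kernel of a full rank matrix $A\in\mathbb{C}^{m\times(n+1)}$, i.e. $L=\mathbb{P}(\ker A)$, and let $z\in Z\cap L$. Then $$\kappa_Z(L,z)\ \le\ \mathrm{kercond}_Z(A,z)\ \le\ \kappa(A)\cdot\kappa_Z(L,z).$$
   Context: Metrics. $\mathbb{C}^{n+1}$ carries its standard hermitian inner product $\langle\cdot,\cdot\rangle$. The tangent space of $\mathbb{P}^n=\mathbb{P}^n(\mathbb{C})$ at the point represented by $z\in\mathbb{C}^{n+1}\setminus\{0\}$ is modelled as $T_z\mathbb{P}^n=\{\dot z\in\mathbb{C}^{n+1}\mid\langle\dot z,z\rangle=0\}$ with hermitian inner product $\langle\dot u,\dot v\rangle_z=\|z\|^{-2}\langle\dot u,\dot v\rangle$ (Fubini-Study metric). $\mathbb{G}(s,\mathbb{P}^n)$ is the complex Grassmann manifold of $s$-dimensional projective linear subspaces $L\subseteq\mathbb{P}^n$, identified with the Grassmann manifold $\mathbb{G}(s+1,\mathbb{C}^{n+1})$ of $(s+1)$-dimensional linear subspaces $\widehat L\subseteq\mathbb{C}^{n+1}$ (with $L=\mathbb{P}(\widehat L)$). Its hermitian metric is the unitarily invariant one: identifying $T_L\mathbb{G}$ with $\mathrm{Hom}(\widehat L,\widehat L^\perp)$ and writing linear maps as matrices $R,S$ in orthonormal bases, $\langle R,S\rangle=\mathrm{tr}(RS^*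 )$. Intersection condition number. For a smooth point $z$ of $Z$ and $L\in\mathbb{G}(s,\mathbb{P}^n)$ with $z\in L$, the intersection is transversal at $z$ if $T_zZ+T_zL=T_z\mathbb{P}^n$. In this case there are open neighborhoods $U$ of $L$ in $\mathbb{G}(s,\mathbb{P}^n)$ and $V$ of $z$ in $Z$ and a holomorphic map $\gamma\colon U\to V$ (the solution map) with $\tilde L\cap V=\{\gamma(\tilde L)\}$ for all $\tilde L\in U$. One sets $\kappa_Z(L,z):=\|D_L\gamma\|$, the operator norm of $D_L\gamma\colon T_L\mathbb{G}\to T_z\mathbb{P}^n$ with respect to the hermitian norm on $T_L\mathbb{G}$ and the Fubini-Study norm on $T_z\mathbb{P}^n$. If $z\in Z\cap L$ is not a smooth point of $Z$ or the intersection at $z$ is not transversal, $\kappa_Z(L,z):=\infty$. Kernel intersection condition number. Let $A\in\mathbb{C}^{m\times(n+1)}$ be of full rank and $z\in Z$ with $Az=0$. If $z$ is a smooth point of $Z$ and $\mathbb{P}(\ker A)$ intersects $Z$ transversally at $z$, there is a holomorphic map $G$ from an open neighborhood $U$ of $A$ in $\mathbb{C}^{m\times(n+1)}$ to an open neighborhood $V$ of $z$ in $Z$ with $\mathbb{P}(\ker\tilde A)\cap V=\{G(\tilde A)\}$ for all $\tilde A\in U$. One sets $\mathrm{kercond}_Z(A,z):=\|A\|\cdot\|D_AG\|$, where $\|A\|$ is the spectral norm and $\|D_AG\|=\sup_{\|\dot A\|_F=1}\|D_AG(\dot A)\|$ with $\|\cdot\|_F$ the Frobenius norm and the Fubini-Study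 norm on $T_z\mathbb{P}^n$. In all other cases $\mathrm{kercond}_Z(A,z):=\infty$. Matrix condition number: $\kappa(A):=\|A\|\cdot\|A^\dagger\|$ with spectral norms, where $A^\dagger$ is the Moore-Penrose inverse. *)

(* Defs.v *)
From HB Require Import structures.
From mathcomp Require Import all_boot all_order all_algebra.
From mathcomp Require Import all_classical all_reals all_analysis.
From mathcomp Require Import complex spectral sesquilinear.
(* The notations of mpoly clash with those of mathcomp-analysis. *)
From mathcomp Require Import -(notations) mpoly.

Set Implicit Arguments.
Unset Strict Implicit.
Unset Printing Implicit Defensive.

Import Order.TTheory GRing.Theory Num.Theory.
Import numFieldNormedType.Exports.

Local Open Scope classical_set_scope.
Local Open Scope ring_scope.
Local Open Scope complex_scope.
Local Open Scope sesquilinear_scope.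

Section LinearAlgebra.
Variable R : realType.
Local Notation C := R[i].

Definition hdot N (u v : 'cV[C]_N) : C := (v^t* *m u) 0 0.

(* The hermitian norm of <A, B> = tr (A B^* ): the Frobenius norm of a matrix,
   and the standard norm of a column vector. *)
Definition fnorm p q (A : 'M[C]_(p, q)) : R :=
  Num.sqrt (complex.Re (\tr (A *m A^t*))).

(* Norm of f as a map from matrices with the Frobenius norm to W with the norm
   nrm; the sup is over the unit sphere, so the source must be nonzero. *)
Definition opnorm p q (W : Type) (nrm : W -> R) (f : 'M[C]_(p, q) -> W) :
    \bar R :=
  ereal_sup [set (nrm (f X))%:E | X in [set X | fnorm X = 1]].

Definition spec_norm p q (A : 'M[C]_(p, q)) : \bar R :=
  opnorm (@fnorm p 1) (fun x : 'cV[C]_q => A *m x).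

Definition is_moore_penrose p q (A : 'M[C]_(p, q)) (X : 'M[C]_(q, p)) : Prop :=
  [/\ A *m X *m A = A, X *m A *m X = X,
      (A *m X)^t* = A *m X & (X *m A)^t* = X *m A].

Definition mpinv p q (A : 'M[C]_(p, q)) : 'M[C]_(q, p) :=
  xget 0 [set X | is_moore_penrose A X].

Definition cond p q (A : 'M[C]_(p, q)) : \bar R :=
  (spec_norm A * spec_norm (mpinv A))%E.

Definition colspan N k (B : 'M[C]_(N, k)) : {vspace 'cV[C]_N} :=
  limg (linfun (mulmx B : 'cV[C]_k -> 'cV[C]_N)).

Definition kerv p N (A : 'M[C]_(p, N)) : {vspace 'cV[C]_N} :=
  lker (linfun (mulmx A : 'cV[C]_N -> 'cV[C]_p)).

End LinearAlgebra.

Section Grassmannian.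
Variables (R : realType) (N k : nat).
Local Notation C := R[i].

Record grass := Grass {
  gval :> {vspace 'cV[C]_N};
  gdim : \dim gval == k }.

HB.instance Definition _ := [isSub for gval].
HB.instance Definition _ := [Choice of grass by <:].

Local Notation frames := ('M[C]_(N, k) : normedModType C).

(* Quotient topology of the set of full rank N x k matrices (with its subspace
   topology) under B |-> colspan B. *)
Definition grass_open (U : set grass) : Prop :=
  exists2 O : set frames, open O &
    forall (L : grass) (B : frames), colspan B = L -> (U L <-> O B).

Lemma grass_openT : grass_open setT.
Proof. by exists setT; [exact: openT | move=> L B _; split]. Qed.

Lemma grass_openI : setI_closed grass_open.
Proof.
move=> U V [S oS hS] [T oT hT]; exists (S `&` T); first exact: openI.
by move=> L B BL; rewrite /setI /= (hS _ _ BL) (hT _ _ BL).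
Qed.

Lemma grass_open_bigU (I : Type) (f : I -> set grass) :
  (forall i, grass_open (f i)) -> grass_open (\bigcup_i f i).
Proof.
move=> fo.
have /choice[S SP] : forall i, exists S : set frames, open S /\
    forall (L : grass) (B : frames), colspan B = L -> (f i L <-> S B).
  by move=> i; have [S oS hS] := fo i; exists S.
exists (\bigcup_i S i); first by apply: bigcup_open => i _; exact: (SP i).1.
by move=> L B BL; split=> -[i _ fi]; exists i => //; apply/((SP i).2 _ _ BL).
Qed.

HB.instance Definition _ :=
  isOpenTopological.Build grass grass_openT grass_openI grass_open_bigU.

(* Orthonormal bases (as columns) of L and of its orthogonal complement. *)
Definition is_onframe (L : grass)
    (F : 'M[C]_(N, k) * 'M[C]_(N, N - k)) : Prop :=
  [/\ F.1^t* *m F.1 = 1%:M, F.2^t* *m F.2 = 1%:M,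
      F.2^t* *m F.1 = 0 & colspan F.1 = L].

Definition onframe (L : grass) : 'M[C]_(N, k) * 'M[C]_(N, N - k) :=
  xget (0, 0) [set F | is_onframe L F].

(* The chart at L: a linear map from L to its orthogonal complement, with
   matrix X in the bases above, is sent to its graph. The derivative of this
   chart at 0 is the identification of Hom(L, L^perp) with the tangent space
   at L. The graph has dimension k, so that insubd never uses its default. *)
Definition gchart (L : grass) (X : 'M[C]_(N - k, k)) : grass :=
  insubd L (colspan ((onframe L).1 + (onframe L).2 *m X)).

End Grassmannian.

Notation projsp R n := (grass R n.+1 1).

Section Projective.
Variables (R : realType) (n : nat).
Local Notation C := R[i].
Local Notation P := (projsp R n).
Local Notation cpoly := (mpoly n.+1 C).

Definition rep (x : P) : 'cV[C]_n.+1 := vpick x.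

(* The Fubini-Study norm on the model rep z ^perp of the tangent space at z. *)
Definition fs_norm (z : P) (u : 'cV[C]_n.+1) : R := fnorm u / fnorm (rep z).

(* The affine chart centered at z, with values in the tangent space at z: the
   vector u orthogonal to rep z such that rep z + u spans x. *)
Definition pchart (z x : P) : 'cV[C]_n.+1 :=
  (hdot (rep z) (rep z) / hdot (rep x) (rep z)) *: rep x - rep z.

Definition homog (p : cpoly) : Prop :=
  exists d : nat, p \is ishomog1 d mdeg.

Definition vanish_at (p : cpoly) (x : P) : Prop :=
  meval (fun i => rep x i 0) p = 0.

Definition zclosed (X : set P) : Prop :=
  exists2 S : set cpoly, S `<=` homog & X = [set x | forall p, S p -> vanish_at p x].

Definition zirreducible (X : set P) : Prop :=
  X !=set0 /\ forall Y1 Y2 : set P, zclosed Y1 -> zclosed Y2 ->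
    X `<=` Y1 `|` Y2 -> X `<=` Y1 \/ X `<=` Y2.

Definition irr_variety (X : set P) : Prop := zclosed X /\ zirreducible X.

Definition irr_chain (Z : set P) (d : nat) : Prop :=
  exists X : nat -> set P,
    (forall i, (i <= d)%N -> irr_variety (X i) /\ X i `<=` Z) /\
    (forall i, (i < d)%N -> X i `<` X i.+1).

(* Krull dimension in the Zariski topology. *)
Definition has_dim (Z : set P) (d : nat) : Prop :=
  irr_chain Z d /\ ~ irr_chain Z d.+1.

(* Tangent spaces (for Z, the Zariski tangent space, cut out by the ideal of Z)
   are sets of vectors in the model rep z ^perp of the tangent space of P^n. *)
Definition tangent_proj (z : P) : set 'cV[C]_n.+1 :=
  [set v | hdot v (rep z) = 0].

Definition tangent_var (Z : set P) (z : P) : set 'cV[C]_n.+1 :=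
  [set v | tangent_proj z v /\
    forall p : cpoly, homog p -> (forall x, Z x -> vanish_at p x) ->
      \sum_(i < n.+1)
        meval (fun j => rep z j 0) (mderiv i p) * v i 0 = 0].

Definition tangent_lin (L : {vspace 'cV[C]_n.+1}) (z : P) : set 'cV[C]_n.+1 :=
  [set v | tangent_proj z v /\ v \in L].

Definition smooth_point (Z : set P) (z : P) : Prop :=
  Z z /\ exists2 d, has_dim Z d &
    exists2 W : {vspace 'cV[C]_n.+1}, \dim W = d & [set` W] = tangent_var Z z.

Definition transversal (Z : set P) (L : {vspace 'cV[C]_n.+1}) (z : P) : Prop :=
  (z <= L)%VS /\
  [set v | exists a b, [/\ tangent_var Z z a, tangent_lin L z b & v = a + b]]
    = tangent_proj z.

Definition open_nbhd_in (Z V : set P) (z : P) : Prop :=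
  V z /\ exists2 O : set P, open O & V = Z `&` O.

Definition points_of (L : {vspace 'cV[C]_n.+1}) : set P :=
  [set x : P | (x <= L)%VS].

Section Grass.
Variable k : nat.
Local Notation G := (grass R n.+1 k).

Definition in_charts (f : G -> P) (L : G) : 'M[C]_(n.+1 - k, k) -> 'cV[C]_n.+1 :=
  fun X => pchart (f L) (f (gchart L X)).

(* Differentiability is over C: a map is holomorphic on an open set when it is
   complex differentiable at each of its points. *)
Definition holomorphic_grass (U : set G) (f : G -> P) : Prop :=
  forall L, U L -> differentiable (in_charts f L) 0.

Definition is_solution_map (Z : set P) (L : G) (z : P) (f : G -> P) : Prop :=
  exists (U : set G) (V : set P),
    [/\ open_nbhs L U, open_nbhd_in Z V z, holomorphic_grass U f &
        forall L', U L' -> points_of L' `&` V = [set f L']].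

(* Under transversality a solution map exists by the implicit function theorem,
   and its germ at L is unique. *)
Definition solution_map (Z : set P) (L : G) (z : P) : G -> P :=
  xget (fun=> z) [set f | is_solution_map Z L z f].

Definition kappa (Z : set P) (L : G) (z : P) : \bar R :=
  if `[< smooth_point Z z /\ transversal Z L z >]
  then opnorm (fs_norm z) ('d (in_charts (solution_map Z L z) L) 0)
  else +oo%E.

End Grass.

Section Kernel.
Variable m : nat.
Local Notation M := ('M[C]_(m, n.+1) : normedModType C).

Definition holomorphic_mx (U : set M) (f : M -> P) : Prop :=
  forall A, U A -> differentiable (fun X => pchart (f A) (f X)) A.

Definition is_ker_solution_map (Z : set P) (A : M) (z : P) (f : M -> P) : Prop :=
  exists (U : set M) (V : set P),
    [/\ open_nbhs A U, open_nbhd_in Z V z, holomorphic_mx U f &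
        forall A', U A' -> points_of (kerv A') `&` V = [set f A']].

Definition ker_solution_map (Z : set P) (A : M) (z : P) : M -> P :=
  xget (fun=> z) [set f | is_ker_solution_map Z A z f].

Definition kercond (Z : set P) (A : M) (z : P) : \bar R :=
  if `[< \rank A = m /\ smooth_point Z z /\ transversal Z (kerv A) z >]
  then (spec_norm A *
    opnorm (fs_norm z)
      ('d (fun X => pchart (ker_solution_map Z A z A)
                           (ker_solution_map Z A z X)) A))%E
  else +oo%E.

End Kernel.

End Projective.

(* Main.v *)
Require Import Defs.
From mathcomp Require Import all_boot all_order all_algebra.
From mathcomp Require Import all_classical all_reals all_analysis.
From mathcomp Require Import complex spectral sesquilinear.
Set Implicit Arguments.
Unset Strict Implicit.
Unset Printing Implicit Defensive.
Import Order.TTheory GRing.Theory Num.Theory.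
Import numFieldNormedType.Exports.
Local Open Scope classical_set_scope.
Local Open Scope ring_scope.
Local Open Scope complex_scope.
Local Open Scope sesquilinear_scope.

(** Let L = ker A, with orthonormal frames F1 of L and F2 of its orthogonal
complement. Then A F1 = 0 and A F2 is invertible, and for every B close to A

  ker B = { x + F2 (X(B) y) | x = F1 y in L },   X(B) = - (B F2)^-1 (B F1),

so X(B) is the coordinate of ker B in the chart of the Grassmannian at L
([kerv_gchart]). Since X(A) = 0, its derivative at A is
H |-> - (A F2)^-1 (H F1) ([diff_solve_mx]).

A solution map for kernels and one for subspaces select the same point of Z
near z, so that near A the former is B |-> gamma (ker B) with gamma the latter
([solution_maps_agree]). By the chain rule

  D_A G (H) = D_L gamma (- (A F2)^-1 (H F1))           ([diff_solution_maps]).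

The Moore-Penrose inverse of A is F2 (A F2)^-1, whose spectral norm is that of
(A F2)^-1, and H |-> H F1 does not increase the Frobenius norm. This gives
kercond <= cond A * kappa. Conversely a tangent vector X at L is the image of
H = - A F2 X F1^*, a matrix with |H| <= |A| |X|, which gives kappa <= kercond.

Both kinds of solution map exist together. A solution map for subspaces yields
one for kernels by composition with B |-> ker B ([ker_of_solution]); conversely
composing with a holomorphic local section of B |-> ker B turns a solution map
for kernels into one for subspaces ([solution_of_ker]). If none exists, the
default values of gamma and G are constant maps, and the formula for D_A G
holds with both sides zero. *)

(** * Differentiation of matrix-valued maps *)

Section DiffNear.
Variables (K : numFieldType) (V W : normedModType K).

(** Differentiability and the differential only depend on the germ: the
remainder of f at x is also the remainder of g. *)
Lemma near_eq_diff (f g : V -> W) (x : V) : {near x, f =1 g} ->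
  differentiable f x -> differentiable g x /\ 'd g x = 'd f x :> (V -> W).
Proof.
move=> fg df.
have E : g \o shift x = cst (g x) + 'd f x +o_ 0 id.
  apply/eqaddoP => e e0.
  have /eqaddoP/(_ e e0) := diff_locally df.
  have fg0 : \forall h \near 0, f (h + x) = g (h + x).
    have : \forall y \near x, f y = g y := fg.
    rewrite (near_shift 0) /= => H.
    by near=> h; rewrite -[x]subr0; near: h; exact: H.
  apply: filter_app; near=> h.
  rewrite !fctE /= (_ : f (h + x) = g (h + x)); last by near: h; exact: fg0.
  by rewrite (nbhs_singleton fg).
have dE := diff_unique (diff_continuous df) E.
split=> //; apply/diff_locallyP; rewrite dE; split=> //.
exact: diff_continuous.
Unshelve. all: by end_near. Qed.

Lemma differentiable_bigsum (I : Type) (r : seq I) (P : pred I)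
    (F : I -> V -> W) (x : V) : (forall i, differentiable (F i) x) ->
  differentiable (fun y => \sum_(i <- r | P i) F i y) x.
Proof.
move=> dF; elim: r => [|i r IH].
  under eq_fun do rewrite big_nil; exact: differentiable_cst.
under eq_fun do rewrite big_cons.
case: (P i) => //; exact: differentiableD.
Qed.

Lemma differentiable_bigprod (I : Type) (r : seq I) (P : pred I)
    (F : I -> V -> K) (x : V) : (forall i, differentiable (F i) x) ->
  differentiable (fun y => \prod_(i <- r | P i) F i y) x.
Proof.
move=> dF; elim: r => [|i r IH].
  under eq_fun do rewrite big_nil; exact: differentiable_cst.
under eq_fun do rewrite big_cons.
case: (P i) => //; exact: differentiableM.
Qed.

End DiffNear.

(** The chain rule for a map that is a composition only near x; maps read in
charts are of this form. *)
Lemma near_comp_diff (K : numFieldType) (U V W : normedModType K) (h : U -> V)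
    (f : V -> W) (g : U -> W) (x : U) (y : V) : h x = y ->
  differentiable h x -> differentiable f y ->
  (\forall t \near x, g t = f (h t)) ->
  differentiable g x /\ forall v, 'd g x v = 'd f y ('d h x v).
Proof.
move=> <- dh df gfh.
have [|dg dgE] :=
  @near_eq_diff _ _ _ (f \o h) g x _ (differentiable_comp dh df).
  by move: gfh; apply: filterS => t ->.
by split=> // v; rewrite dgE diff_comp.
Qed.

Section DiffMatrix.
Variables (K : numFieldType) (V : normedModType K) (x : V).

Lemma differentiable_mxP (p q : nat) (F : V -> 'M[K]_(p, q)) :
  differentiable F x <-> forall i j, differentiable (fun y => F y i j) x.
Proof.
split=> [dF i j|dF].
  exact: (differentiable_comp dF (differentiable_coord _ i j)).
have -> : F = fun y => \sum_i \sum_j F y i j *: delta_mx i j.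
  by apply/funext => y; rewrite -matrix_sum_delta.
apply: differentiable_bigsum => i; apply: differentiable_bigsum => j.
exact: differentiableZl.
Qed.

Lemma differentiable_mulmx (p q r : nat) (F : V -> 'M[K]_(p, q))
    (G : V -> 'M[K]_(q, r)) : differentiable F x -> differentiable G x ->
  differentiable (fun y => F y *m G y) x.
Proof.
move=> /differentiable_mxP dF /differentiable_mxP dG.
apply/differentiable_mxP => i j; under eq_fun do rewrite mxE.
by apply: differentiable_bigsum => l; apply: differentiableM.
Qed.

Lemma differentiable_mulmxl (p q r : nat) (B : 'M[K]_(p, q))
    (F : V -> 'M[K]_(q, r)) :
  differentiable F x -> differentiable (fun y => B *m F y) x.
Proof.
by move=> dF; apply: differentiable_mulmx => //; exact: differentiable_cst.
Qed.

Lemma differentiable_mulmxr (p q r : nat) (F : V -> 'M[K]_(p, q))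
    (B : 'M[K]_(q, r)) :
  differentiable F x -> differentiable (fun y => F y *m B) x.
Proof.
by move=> dF; apply: differentiable_mulmx => //; exact: differentiable_cst.
Qed.

Lemma differentiable_det (n : nat) (F : V -> 'M[K]_n) :
  differentiable F x -> differentiable (fun y => \det (F y)) x.
Proof.
move=> /differentiable_mxP dF; apply: differentiable_bigsum => s.
apply: differentiableM; first exact: differentiable_cst.
exact: differentiable_bigprod.
Qed.

Lemma near_unitmx (n : nat) (F : V -> 'M[K]_n) :
  differentiable F x -> F x \in unitmx -> \forall y \near x, F y \in unitmx.
Proof.
move=> dF Fx; have dc := differentiable_continuous (differentiable_det dF).
have : \det (F x) != 0 by rewrite -unitfE -unitmxE.
move=> /(cvgr_neq0 _ dc).
by apply: filter_app; near=> y => dy; rewrite unitmxE unitfE.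
Unshelve. all: by end_near. Qed.

(** Where F is invertible, Cramer's rule makes the entries of its inverse
rational functions of its entries. *)
Lemma differentiable_invmx (n : nat) (F : V -> 'M[K]_n) :
  differentiable F x -> F x \in unitmx ->
  differentiable (fun y => invmx (F y)) x.
Proof.
move=> dF Fx.
apply: (proj1 (@near_eq_diff _ _ _ (fun y => (\det (F y))^-1 *: \adj (F y))
                 (fun y => invmx (F y)) x _ _)).
  have := near_unitmx dF Fx; apply: filter_app; near=> y => Fy.
  by rewrite /invmx Fy.
apply/differentiable_mxP => i j; under eq_fun do rewrite !mxE.
apply: differentiableM.
  apply: differentiableV; first exact: differentiable_det.
  by rewrite -unitfE -unitmxE.
apply: differentiableM; first exact: differentiable_cst.
apply: differentiable_det; apply/differentiable_mxP => i' j'.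
under eq_fun do rewrite !mxE.
by move/differentiable_mxP: dF; apply.
Unshelve. all: by end_near. Qed.

End DiffMatrix.

Section DiffSolve.
Variables (K : numFieldType) (p q N : nat).
Variables (F1 : 'M[K]_(N, q)) (F2 : 'M[K]_(N, p)).
Implicit Types (A H : 'M[K]_(p, N)).

(** The solution X of A (F1 + F2 X) = 0 when A F2 is invertible. *)
Definition solve_mx A : 'M[K]_(p, q) := - (invmx (A *m F2) *m (A *m F1)).

Lemma near_solvable A : A *m F2 \in unitmx ->
  \forall B \near A, B *m F2 \in unitmx.
Proof.
move=> Au; apply: (@near_unitmx _ _ A _ (fun B => B *m F2)) => //.
exact: differentiable_mulmxr.
Qed.

Lemma differentiable_solve_mx A : A *m F2 \in unitmx ->
  differentiable solve_mx A.
Proof.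
move=> Au; apply: differentiableN; apply: differentiable_mulmx.
  by apply: differentiable_invmx => //; exact: differentiable_mulmxr.
exact: differentiable_mulmxr.
Qed.

(** Since A F1 = 0, the increment of [solve_mx] in the direction H is exactly
- ((A + h H) F2)^-1 (h H F1), so that only the continuity of the inverse enters
the limit. *)
Lemma diff_solve_mx A H : A *m F2 \in unitmx -> A *m F1 = 0 ->
  'd solve_mx A H = - (invmx (A *m F2) *m (H *m F1)).
Proof.
move=> Au A1; rewrite -deriveE; last exact: differentiable_solve_mx.
pose F (h : K) : 'M[K]_(p, q) := - (invmx ((h *: H + A) *m F2) *m (H *m F1)).
have F0 : F 0 = - (invmx (A *m F2) *m (H *m F1)) by rewrite /F scale0r add0r.
have cF : {for 0, continuous F}.
  apply: differentiable_continuous; apply: differentiableN.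
  apply: differentiable_mulmxr; apply: differentiable_invmx.
    by apply: differentiable_mulmxr; apply: differentiableD.
  by rewrite scale0r add0r.
rewrite -F0; apply: cvg_lim => //.
have cF' : F h @[h --> 0^'] --> F 0 by apply: cvg_within_filter.
apply: cvg_trans cF'; apply: near_eq_cvg.
near=> h; have h0 : h != 0 by near: h; exact: nbhs_dnbhs_neq.
suff : F h = h^-1 *: (solve_mx (h *: H + A) - solve_mx A) by [].
rewrite /solve_mx A1 mulmx0 oppr0 subr0 [(_ + A) *m F1]mulmxDl A1 addr0.
by rewrite -scalemxAl -scalemxAr scalerN scalerA mulVf // scale1r.
Unshelve. all: by end_near. Qed.

End DiffSolve.

(** * Frames, kernels and the charts of the Grassmannian *)

Lemma mulmx1C_cast (F : fieldType) (m n : nat) (A : 'M[F]_(m, n))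
    (B : 'M[F]_(n, m)) : m = n -> A *m B = 1%:M -> B *m A = 1%:M.
Proof. by move=> e; case: n / e A B => A B /mulmx1C. Qed.

Section Frames.
Variable R : realType.
Local Notation C := R[i].

Lemma ctrmx_mul (m n p : nat) (A : 'M[C]_(m, n)) (B : 'M[C]_(n, p)) :
  (A *m B)^t* = B^t* *m A^t*.
Proof. by rewrite trmx_mul map_mxM. Qed.

Lemma ctrmx1 (n : nat) : (1%:M : 'M[C]_n)^t* = 1%:M.
Proof. by rewrite trmx1 map_mx1. Qed.

Lemma ctrmx0 (m n : nat) : (0 : 'M[C]_(m, n))^t* = 0.
Proof. by rewrite trmx0 map_mx0. Qed.

Lemma colspanP (N k : nat) (B : 'M[C]_(N, k)) (v : 'cV[C]_N) :
  reflect (exists x, v = B *m x) (v \in colspan B).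
Proof.
apply: (iffP memv_imgP) => [[x _ ->]|[x ->]]; exists x; rewrite ?lfunE //.
exact: memvf.
Qed.

Lemma mem_kerv (p N : nat) (A : 'M[C]_(p, N)) (v : 'cV[C]_N) :
  (v \in kerv A) = (A *m v == 0).
Proof. by rewrite memv_ker lfunE. Qed.

Lemma colspan_eqP (N k : nat) (B B' : 'M[C]_(N, k)) :
  colspan B = colspan B' -> exists P, B = B' *m P.
Proof.
move=> e; have /choice[x xE] : forall j, exists x, col j B = B' *m x.
  move=> j; apply/colspanP; rewrite -e; apply/colspanP.
  by exists (delta_mx j 0); rewrite colE.
exists (\matrix_(i, j) x j i 0); apply/matrixP => i j.
have /matrixP/(_ i 0) := xE j; rewrite !mxE => ->.
by apply: eq_bigr => l _; rewrite mxE.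
Qed.

Lemma dim_colspan (N k : nat) (B : 'M[C]_(N, k)) (T : 'M[C]_(k, N)) :
  T *m B = 1%:M -> \dim (colspan B) = k.
Proof.
move=> TB; rewrite limg_dim_eq; first by rewrite dimvf /dim /= muln1.
apply/eqP; rewrite -subv0; apply/subvP => v; rewrite memv_cap memvf /=.
rewrite memv_ker lfunE /= => /eqP Bv.
by rewrite memv0 -[v]mul1mx -TB -mulmxA Bv mulmx0.
Qed.

Lemma unitmx_inj (n : nat) (A : 'M[C]_n) :
  (forall x : 'cV_n, A *m x = 0 -> x = 0) -> A \in unitmx.
Proof.
move=> inj; rewrite -row_full_unit /row_full -mxrank_tr -/(row_free _).
rewrite -kermx_eq0; apply/eqP/row_matrixP => i; rewrite row0.
apply: trmx_inj; rewrite trmx0; apply: inj; apply: trmx_inj.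
by rewrite trmx_mul trmxK -row_mul mulmx_ker row0 trmx0.
Qed.

Variables (N k : nat).
Implicit Types (L : grass R N k).

Lemma grass_leq L : (k <= N)%N.
Proof.
by have := dimvS (subvf (gval L)); rewrite (eqP (gdim L)) dimvf /dim /= muln1.
Qed.

(** [schmidt] orthonormalizes rows: it is applied to the transpose of a basis of
L, and to a row basis of the left kernel of the adjoint of the result. *)
Lemma onframe_exists L : exists F, is_onframe L F.
Proof.
have kN := grass_leq L.
pose b := vbasis (gval L).
have dL : \dim (gval L) = k := eqP (gdim L).
have sb : size b = k by rewrite size_tuple dL.
pose V : 'M[C]_(k, N) := \matrix_(i < k) (b`_i)^T.
have LV (v : 'cV[C]_N) : (v \in gval L) = (v^T <= V)%MS.
  apply/idP/idP => [vL|/submxP[x xE]].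
    have -> : v^T = \sum_(i < k)
        coord (vbasis (gval L)) (cast_ord (esym dL) i) v *: row i V.
      rewrite {1}(coord_vbasis vL) linear_sum /=.
      rewrite (reindex (cast_ord (esym dL))) /=; last first.
        by exists (cast_ord dL) => i _; apply: val_inj.
      by apply: eq_bigr => i _; rewrite linearZ rowK.
    by apply: summx_sub => i _; apply/scalemx_sub/row_sub.
  rewrite -[v]trmxK xE mulmx_sum_row linear_sum /=.
  apply: memv_suml => i _; rewrite linearZ rowK /= trmxK; apply: memvZ.
  by apply: vbasis_mem; rewrite mem_nth // sb.
have Vfree : row_free V.
  rewrite -kermx_eq0; apply/eqP/row_matrixP => i; rewrite row0.
  set x := row i _; have xV : x *m V = 0 by rewrite -row_mul mulmx_ker row0.
  have /freeP := basis_free (vbasisP (gval L)).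
  move=> /(_ (fun j => x 0 (cast_ord dL j))) H.
  apply/rowP => j; rewrite [RHS]mxE -(H _ (cast_ord (esym dL) j)).
    by congr (x _ _); apply: val_inj.
  apply: trmx_inj; rewrite trmx0 -xV mulmx_sum_row linear_sum /=.
  rewrite (reindex (cast_ord (esym dL))) /=; last first.
    by exists (cast_ord dL) => l _; apply: val_inj.
  apply: eq_bigr => l _; rewrite linearZ rowK; congr (_ *: _).
  by congr (x _ _); apply: val_inj.
pose U := schmidt V.
have Uu : U *m U^t* = 1%:M by apply/unitarymxP/schmidt_unitarymx.
have UV : (U :=: V)%MS := eqmx_schmidt_free Vfree.
have rU : \rank U = k by rewrite UV; apply/eqP.
have [W Wu WU] : exists2 W : 'M[C]_(N - k, N), W *m W^t* = 1%:M & W *m U^t* = 0.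
  pose X := kermx (U^t*).
  have : \rank X = (N - k)%N by rewrite mxrank_ker mxrank_map mxrank_tr rU.
  move: (N - k)%N => r rX; case: r / rX.
  exists (schmidt (row_base X)).
    by apply/unitarymxP/schmidt_unitarymx; exact: rank_leq_col.
  apply/sub_kermxP; rewrite eqmx_schmidt_free ?row_base_free //.
  by rewrite eq_row_base.
have tr_tc p q r (A : 'M[C]_(p, q)) (B : 'M[C]_(r, q)) :
    A^T^t* *m B^T = (B *m A^t*)^T.
  by rewrite trmx_mul map_trmx trmxK.
exists (U^T, W^T); split => /=.
- by rewrite tr_tc Uu trmx1.
- by rewrite tr_tc Wu trmx1.
- rewrite tr_tc; have := congr1 (fun A => A^t*) WU.
  by rewrite ctrmx_mul trmxCK ctrmx0 => ->; rewrite trmx0.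
apply/vspaceP => v; rewrite LV -UV; apply/colspanP/submxP => -[x xE].
  by exists x^T; rewrite xE trmx_mul trmxK.
by exists x^T; rewrite -[v]trmxK xE trmx_mul.
Qed.

Lemma onframeP L : is_onframe L (onframe L).
Proof.
by apply: (@xgetPex _ _ [set F | is_onframe L F]); exact: onframe_exists.
Qed.

Lemma onframe12 L : (onframe L).1^t* *m (onframe L).2 = 0.
Proof.
have [_ _ F21 _] := onframeP L.
by have := congr1 (fun A => A^t*) F21; rewrite ctrmx_mul trmxCK ctrmx0.
Qed.

(** The two frames form a square matrix, up to the cast k + (N - k) = N. *)
Lemma onframe_complete L (F := onframe L) :
  F.1 *m F.1^t* + F.2 *m F.2^t* = 1%:M.
Proof.
have [F11 F22 F21 _] := onframeP L; rewrite -/F in F11 F22 F21.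
rewrite -mul_row_col; apply: mulmx1C_cast; first exact/subnKC/(grass_leq L).
by rewrite mul_col_row F11 F22 F21 onframe12 -scalar_mx_block.
Qed.

Lemma gchart_val L (X : 'M[C]_(N - k, k)) :
  gval (gchart L X) = colspan ((onframe L).1 + (onframe L).2 *m X).
Proof.
rewrite /gchart [gval _]val_insubd; case: ifPn => // /negP[]; apply/eqP.
apply: (@dim_colspan _ _ _ ((onframe L).1^t*)).
have [F11 _ _ _] := onframeP L.
by rewrite mulmxDr F11 mulmxA onframe12 mul0mx addr0.
Qed.

Lemma gchart0 L : gchart L 0 = L.
Proof.
apply: val_inj; rewrite /= gchart_val mulmx0 addr0.
by have [] := onframeP L.
Qed.

Definition ker_coord L (A : 'M[C]_(N - k, N)) : 'M[C]_(N - k, k) :=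
  solve_mx (onframe L).1 (onframe L).2 A.

(** Writing v = F1 a + F2 b, the equation A v = 0 reads b = X a with
X = - (A F2)^-1 (A F1). *)
Lemma kerv_gchart L (A : 'M[C]_(N - k, N)) :
  A *m (onframe L).2 \in unitmx -> kerv A = gval (gchart L (ker_coord L A)).
Proof.
move=> Au; rewrite gchart_val; have [F11 F22 F21 _] := onframeP L.
have F12 := onframe12 L; have Fc := onframe_complete L.
move: Au F11 F22 F21 F12 Fc; rewrite /ker_coord /solve_mx.
move: (onframe L) => [F1 F2] /= Au F11 F22 F21 F12 Fc.
apply/vspaceP => v; rewrite mem_kerv; apply/eqP/colspanP => [Av|[x ->]].
  exists (F1^t* *m v).
  have e : A *m F2 *m (F2^t* *m v) = - (A *m F1 *m (F1^t* *m v)).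
    apply/eqP; rewrite -addr_eq0 addrC; apply/eqP.
    rewrite -Av -[in RHS](mul1mx v) -Fc mulmxDl mulmxDr.
    by rewrite !mulmxA.
  rewrite mulmxDl mulmxN mulNmx -!mulmxA (mulmxA A) -mulmxN -mulmxN -e.
  by rewrite mulKmx // !mulmxA -mulmxDl Fc mul1mx.
by rewrite mulmxA mulmxDr !mulmxN (mulmxA A F2) mulKVmx // subrr mul0mx.
Qed.

(** A F2 is injective because a vector of ker A = L in the range of F2 is
orthogonal to itself. *)
Lemma kerv_unit L (A : 'M[C]_(N - k, N)) :
  gval L = kerv A -> A *m (onframe L).2 \in unitmx.
Proof.
move=> LA; have [F11 F22 F21 F1L] := onframeP L.
apply: unitmx_inj => x; rewrite -mulmxA => /eqP; rewrite -mem_kerv -LA -F1L.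
move=> /colspanP[y xy].
by rewrite -[x]mul1mx -F22 -mulmxA xy mulmxA F21 mul0mx.
Qed.

Lemma kerv_mul0 L (A : 'M[C]_(N - k, N)) :
  gval L = kerv A -> A *m (onframe L).1 = 0.
Proof.
move=> LA; have [F11 F22 F21 F1L] := onframeP L.
apply/matrixP => i j; have : col j (onframe L).1 \in kerv A.
  by rewrite -LA -F1L; apply/colspanP; exists (delta_mx j 0); rewrite colE.
rewrite mem_kerv => /eqP; rewrite colE mulmxA -colE => /matrixP/(_ i 0).
by rewrite !mxE.
Qed.

Lemma ker_coord0 L (A : 'M[C]_(N - k, N)) :
  gval L = kerv A -> ker_coord L A = 0.
Proof.
by move=> LA; rewrite /ker_coord /solve_mx kerv_mul0 // mulmx0 oppr0.
Qed.

Lemma mpinv_kerv L (A : 'M[C]_(N - k, N)) : gval L = kerv A ->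
  mpinv A = (onframe L).2 *m invmx (A *m (onframe L).2).
Proof.
move=> LA; have Au := kerv_unit LA; have A1 := kerv_mul0 LA.
have [F11 F22 F21 _] := onframeP L; have F12 := onframe12 L.
have Fc := onframe_complete L.
move: Au A1 F11 F22 F21 F12 Fc; move: (onframe L) => [F1 F2] /=.
move=> Au A1 F11 F22 F21 F12 Fc; set X := F2 *m _.
have AX : A *m X = 1%:M by rewrite /X mulmxA mulmxV.
have XA : X *m A = F2 *m F2^t*.
  rewrite -[A in LHS]mulmx1 -Fc mulmxDr (mulmxA A F1) A1 mul0mx add0r.
  by rewrite /X -mulmxA (mulmxA A) mulKmx.
have XP : is_moore_penrose A X.
  split; first by rewrite AX mul1mx.
  - by rewrite -mulmxA AX mulmx1.
  - by rewrite AX ctrmx1.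
  - by rewrite XA ctrmx_mul trmxCK.
rewrite /mpinv; apply: xget_unique => // Y [Y1 Y2 _ Y4].
have AY : A *m Y = 1%:M.
  by rewrite -[LHS]mulmx1 -AX (mulmxA _ A) Y1.
(* X A and Y A are both the orthogonal projection onto the range of A^*. *)
have -> : Y = (X *m A)^t* *m (Y *m A)^t* *m Y.
  by rewrite -ctrmx_mul -mulmxA (mulmxA A X) AX mul1mx Y4 Y2.
rewrite Y4 XA ctrmx_mul trmxCK -XA.
by rewrite -!mulmxA (mulmxA A Y) AY !mulmx1.
Qed.

End Frames.

(** * Frobenius and operator norms *)

Section Norms.
Variable R : realType.
Local Notation C := R[i].

Definition sqnorm (p q : nat) (A : 'M[C]_(p, q)) : R :=
  complex.Re (\tr (A *m A^t*)).

Lemma sqnormE (p q : nat) (A : 'M[C]_(p, q)) :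
  sqnorm A = \sum_i \sum_j (complex.Re (A i j) ^+ 2 + complex.Im (A i j) ^+ 2).
Proof.
rewrite /sqnorm /mxtrace raddf_sum; apply: eq_bigr => i _ /=.
rewrite mxE raddf_sum; apply: eq_bigr => j _ /=.
by rewrite !mxE; case: (A i j) => a b /=; rewrite mulrN opprK !expr2.
Qed.

Lemma sqnorm_ge0 (p q : nat) (A : 'M[C]_(p, q)) : 0 <= sqnorm A.
Proof.
rewrite sqnormE; apply: sumr_ge0 => i _; apply: sumr_ge0 => j _.
by rewrite addr_ge0 ?sqr_ge0.
Qed.

Lemma sqr_fnorm (p q : nat) (A : 'M[C]_(p, q)) : fnorm A ^+ 2 = sqnorm A.
Proof. by rewrite sqr_sqrtr // sqnorm_ge0. Qed.

Lemma fnorm_ge0 (p q : nat) (A : 'M[C]_(p, q)) : 0 <= fnorm A.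
Proof. exact: sqrtr_ge0. Qed.

Lemma fnorm0 (p q : nat) : fnorm (0 : 'M[C]_(p, q)) = 0.
Proof. by rewrite /fnorm mul0mx linear0 sqrtr0. Qed.

Lemma fnorm_eq0 (p q : nat) (A : 'M[C]_(p, q)) : fnorm A = 0 -> A = 0.
Proof.
move=> A0; have : sqnorm A = 0 by rewrite -sqr_fnorm A0 expr0n.
rewrite sqnormE => /eqP; rewrite psumr_eq0; last first.
  by move=> i _; apply: sumr_ge0 => j _; rewrite addr_ge0 ?sqr_ge0.
move=> /allP H; apply/matrixP => i j.
have := H i; rewrite mem_index_enum => /(_ isT) /implyP /(_ isT).
rewrite psumr_eq0; last by move=> l _; rewrite addr_ge0 ?sqr_ge0.
move=> /allP /(_ j); rewrite mem_index_enum => /(_ isT) /implyP /(_ isT).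
rewrite paddr_eq0 ?sqr_ge0 // !sqrf_eq0 mxE => /andP[/eqP a /eqP b].
by case: (A i j) a b => /= ? ? -> ->.
Qed.

Lemma fnormZ (p q : nat) (r : R) (A : 'M[C]_(p, q)) : 0 <= r ->
  fnorm (r%:C *: A) = r * fnorm A.
Proof.
move=> r0; apply: (pexpIrn (n := 2)) => //.
- by rewrite nnegrE fnorm_ge0.
- by rewrite nnegrE mulr_ge0 ?fnorm_ge0.
rewrite exprMn !sqr_fnorm !sqnormE mulr_sumr; apply: eq_bigr => i _.
rewrite mulr_sumr; apply: eq_bigr => j _; rewrite mxE.
case: (A i j) => a b /=; rewrite !mul0r subr0 addr0.
by rewrite !exprMn mulrDr.
Qed.

Lemma fnormN (p q : nat) (A : 'M[C]_(p, q)) : fnorm (- A) = fnorm A.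
Proof.
by rewrite /fnorm [(- A)^T]linearN map_mxN mulNmx mulmxN opprK.
Qed.

Lemma fnorm_isol (p q r : nat) (F : 'M[C]_(p, q)) (A : 'M[C]_(q, r)) :
  F^t* *m F = 1%:M -> fnorm (F *m A) = fnorm A.
Proof.
move=> Fu; rewrite /fnorm ctrmx_mul mulmxA mxtrace_mulC.
by rewrite !mulmxA Fu mul1mx.
Qed.

Lemma fnorm_isor (p q r : nat) (F : 'M[C]_(p, q)) (A : 'M[C]_(r, q)) :
  F^t* *m F = 1%:M -> fnorm (A *m F^t*) = fnorm A.
Proof.
by move=> Fu; rewrite /fnorm ctrmx_mul trmxCK -mulmxA (mulmxA _ F) Fu mul1mx.
Qed.

(** Pythagoras: |A|^2 = |A F1|^2 + |A F2|^2. *)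
Lemma fnorm_onframe_le (N k p : nat) (L : grass R N k) (A : 'M[C]_(p, N)) :
  fnorm (A *m (onframe L).1) <= fnorm A.
Proof.
rewrite -(@ler_pXn2r _ 2) ?nnegrE ?fnorm_ge0 // !sqr_fnorm.
have -> : sqnorm A = sqnorm (A *m (onframe L).1) + sqnorm (A *m (onframe L).2).
  rewrite /sqnorm -raddfD -linearD /= !ctrmx_mul -!mulmxA -mulmxDr !mulmxA.
  by rewrite -mulmxDl onframe_complete mul1mx.
by rewrite lerDl sqnorm_ge0.
Qed.

Lemma sqnorm_col (p q : nat) (A : 'M[C]_(p, q)) :
  sqnorm A = \sum_j sqnorm (col j A).
Proof.
rewrite sqnormE exchange_big; apply: eq_bigr => j _ /=.
rewrite sqnormE; apply: eq_bigr => i _.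
by rewrite big_ord1 mxE.
Qed.

(** The target norm is a rescaled standard norm: the Fubini-Study norm at z is
the case c = |z|, the spectral norm the case c = 1. *)
Section OpNorm.
Variables (p q N : nat) (c : R) (f : 'M[C]_(p, q) -> 'cV[C]_N).
Hypothesis c0 : 0 <= c.
Hypothesis fZ : forall (r : R) X, f (r%:C *: X) = r%:C *: f X.
Let nrm (u : 'cV[C]_N) : R := fnorm u / c.

Lemma fnorm_normalize (X : 'M[C]_(p, q)) : X != 0 ->
  0 < fnorm X /\ fnorm ((fnorm X)^-1%:C *: X) = 1.
Proof.
move=> X0; have Xp : 0 < fnorm X.
  rewrite lt_neqAle fnorm_ge0 andbT eq_sym.
  by apply: contra_neq X0 => /fnorm_eq0.
by split => //; rewrite fnormZ ?invr_ge0 ?fnorm_ge0 // mulVf // gt_eqF.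
Qed.

(** Stated in the extended reals, so that it holds before [opnorm] is known to
be finite. *)
Lemma opnorm_ub (X : 'M[C]_(p, q)) :
  ((nrm (f X))%:E <= (fnorm X)%:E * opnorm nrm f)%E.
Proof.
have [->|X0] := eqVneq X 0.
  rewrite fnorm0 mul0e -[X in f X](scale0r (0 : 'M[C]_(p, q))) fZ scale0r.
  by rewrite /nrm fnorm0 mul0r.
have [Xp X1] := fnorm_normalize X0.
have -> : nrm (f X) = fnorm X * nrm (f ((fnorm X)^-1%:C *: X)).
  rewrite fZ /nrm fnormZ ?invr_ge0 ?fnorm_ge0 // !mulrA mulfV ?mul1r //.
  by rewrite gt_eqF.
rewrite EFinM lee_pmul2l // ?lte_fin //.
by apply: ereal_sup_ubound; exists ((fnorm X)^-1%:C *: X).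
Qed.

(** The unit sphere has to be nonempty, for the supremum of the empty set is
-oo. *)
Lemma opnorm_ge0 : (0 < p)%N -> (0 < q)%N -> (0 <= opnorm nrm f)%E.
Proof.
move=> p0 q0.
pose E : 'M[C]_(p, q) := const_mx 1.
have E0 : E != 0.
  apply/eqP => /matrixP /(_ (Ordinal p0) (Ordinal q0)).
  by rewrite !mxE => /eqP; rewrite oner_eq0.
have [_ E1] := fnorm_normalize E0.
apply: (@le_trans _ _ (nrm (f ((fnorm E)^-1%:C *: E)))%:E).
  by rewrite lee_fin divr_ge0 ?fnorm_ge0.
by apply: ereal_sup_ubound; exists ((fnorm E)^-1%:C *: E).
Qed.

End OpNorm.

Lemma opnorm1E (p q N : nat) (f : 'M[C]_(p, q) -> 'cV[C]_N) :
  opnorm (@fnorm R N 1) f = opnorm (fun u => fnorm u / 1) f.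
Proof. by congr opnorm; apply/funext => u; rewrite divr1. Qed.

Lemma mulmx_realZ (p q r : nat) (A : 'M[C]_(p, q)) (a : R) (X : 'M[C]_(q, r)) :
  A *m (a%:C *: X) = a%:C *: (A *m X).
Proof. by rewrite scalemxAr. Qed.

Lemma spec_norm_ge0 (p q : nat) (A : 'M[C]_(p, q)) : (0 < q)%N ->
  (0 <= spec_norm A)%E.
Proof. by move=> q0; rewrite /spec_norm opnorm1E opnorm_ge0. Qed.

Lemma spec_norm_gt0 (p q : nat) (A : 'M[C]_(p, q)) : A != 0 ->
  (0 < spec_norm A)%E.
Proof.
move=> A0; have [j Aj] : exists j, col j A != 0.
  apply: contrapT => H; move/eqP: A0; apply; apply/matrixP => i j.
  have : col j A = 0.
    by apply/eqP; apply: contrapT => /negP ?; apply: H; exists j.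
  by move=> /matrixP /(_ i 0); rewrite !mxE.
have q0 : (0 < q)%N by case: j {Aj} => j; apply: leq_trans.
rewrite lt_neqAle spec_norm_ge0 // andbT; apply/eqP => s0.
move: Aj; rewrite colE => /eqP; apply; apply: fnorm_eq0; apply/eqP.
rewrite eq_le fnorm_ge0 andbT.
have := opnorm_ub 1 (@mulmx_realZ p q 1 A) (delta_mx j 0).
by rewrite -opnorm1E -/(spec_norm A) -s0 mule0 divr1 lee_fin.
Qed.

(** Each column of A M is the image by A of a column of M, and the squared
Frobenius norm is the sum of the squared norms of the columns. *)
Lemma spec_norm_ub (p q r : nat) (A : 'M[C]_(p, q)) (M : 'M[C]_(q, r)) :
  (0 < q)%N -> fnorm M <= 1 -> ((fnorm (A *m M))%:E <= spec_norm A)%E.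
Proof.
move=> q0 M1; have := @opnorm_ub _ _ _ 1 _ (@mulmx_realZ p q 1 A).
rewrite -opnorm1E -/(spec_norm A).
have := spec_norm_ge0 A q0; case: (spec_norm A) => [s||] //.
  2: by move=> _ _; rewrite leey.
rewrite !lee_fin => s0 H.
rewrite -(@ler_pXn2r _ 2) ?nnegrE ?fnorm_ge0 //.
apply: (@le_trans _ _ (s ^+ 2 * fnorm M ^+ 2)); last first.
  by rewrite ler_piMr ?sqr_ge0 // expr_le1 // fnorm_ge0.
rewrite !sqr_fnorm !sqnorm_col mulr_sumr; apply: ler_sum => j _.
rewrite -!sqr_fnorm -exprMn ler_pXn2r ?nnegrE ?mulr_ge0 ?fnorm_ge0 //.
have := H (col j M); rewrite divr1 -EFinM lee_fin mulrC colE mulmxA -colE.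
exact.
Qed.

End Norms.

(** * A local section of the map from matrices to kernels *)

Section GrassTopology.
Variables (R : realType) (N k : nat).
Local Notation C := R[i].
Local Notation charts := ('M[C]_(N - k, k) : normedModType C).
Local Notation grass := (grass R N k).
Implicit Types (L : grass).

Lemma frame_change L (B : 'M[C]_(N, k)) : colspan B = gval L ->
  exists2 P, P \in unitmx & B = (onframe L).1 *m P.
Proof.
move=> BL; have [F11 _ _ FL] := onframeP L.
have [P BP] : exists P, B = (onframe L).1 *m P.
  by apply: colspan_eqP; rewrite BL FL.
have [Q FQ] : exists Q, (onframe L).1 = B *m Q.
  by apply: colspan_eqP; rewrite BL FL.
exists P => //; have : P *m Q = 1%:M.
  by rewrite -F11 {2}FQ BP -!mulmxA (mulmxA (_^t*)) F11 mul1mx.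
by move/mulmx1_unit => [].
Qed.

Lemma gchart_near L (U : set grass) : open U -> U L ->
  \forall X \near (0 : charts), U (gchart L X).
Proof.
move=> [S oS SP] UL.
pose fr (X : 'M[C]_(N - k, k)) := (onframe L).1 + (onframe L).2 *m X.
have dfr : differentiable fr (0 : charts).
  apply: differentiableD; first exact: differentiable_cst.
  exact: differentiable_mulmxl.
have S0 : S (fr 0).
  by apply/(SP L) => //; rewrite /fr mulmx0 addr0; have [] := onframeP L.
have : \forall X \near (0 : charts), S (fr X).
  exact: (differentiable_continuous dfr) (open_nbhs_nbhs (conj oS S0)).
apply: filterS => X SX; apply/(SP _ (fr X)) => //.
by rewrite gchart_val.
Qed.

(** The coordinate of colspan B in the chart at L. *)
Definition frame_slope L (B : 'M[C]_(N, k)) : 'M[C]_(N - k, k) :=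
  (onframe L).2^t* *m B *m invmx ((onframe L).1^t* *m B).

(** A matrix with kernel colspan B that is holomorphic in B and takes the value
A at the frame F1 of ker A: the equation F2^* v = X F1^* v of the graph of X,
multiplied by A F2 since A = (A F2) F2^*. *)
Definition frame_sec L (A : 'M[C]_(N - k, N)) (B : 'M[C]_(N, k)) :
    'M[C]_(N - k, N) :=
  A *m (onframe L).2 *m
    ((onframe L).2^t* - frame_slope L B *m (onframe L).1^t*).

Lemma frame_slope_mulmx L (B : 'M[C]_(N, k)) (P : 'M[C]_k) : P \in unitmx ->
  (onframe L).1^t* *m B \in unitmx ->
  frame_slope L (B *m P) = frame_slope L B.
Proof.
move=> Pu Bu; rewrite /frame_slope mulmxA.
have BPu : (onframe L).1^t* *m (B *m P) \in unitmx.
  by rewrite mulmxA unitmx_mul Bu Pu.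
apply: (can_inj (mulmxK BPu)); rewrite mulmxKV //.
by rewrite (mulmxA _ B P) mulmxA mulmxKV.
Qed.

Lemma frame_sec_mulmx L A (B : 'M[C]_(N, k)) (P : 'M[C]_k) : P \in unitmx ->
  (onframe L).1^t* *m B \in unitmx -> frame_sec L A (B *m P) = frame_sec L A B.
Proof. by move=> Pu Bu; rewrite /frame_sec (frame_slope_mulmx Pu Bu). Qed.

Lemma differentiable_frame_sec (V : normedModType C) L A (x : V)
    (B : V -> 'M[C]_(N, k)) :
  differentiable B x -> (onframe L).1^t* *m B x \in unitmx ->
  differentiable (fun y => frame_sec L A (B y)) x.
Proof.
move=> dB Bu; apply: differentiable_mulmxl; apply: differentiableB.
  exact: differentiable_cst.
apply: differentiable_mulmxr; apply: differentiable_mulmx.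
  exact: differentiable_mulmxl.
by apply: differentiable_invmx => //; exact: differentiable_mulmxl.
Qed.

Lemma frame_sec0 L A : gval L = kerv A -> frame_sec L A (onframe L).1 = A.
Proof.
move=> LA; have [F11 F22 F21 _] := onframeP L.
rewrite /frame_sec /frame_slope F21 !mul0mx subr0 -mulmxA.
have := onframe_complete L => /(congr1 (mulmx A)).
by rewrite mulmxDr mulmxA kerv_mul0 // mul0mx add0r mulmx1.
Qed.

Lemma kerv_frame_sec L A (B : 'M[C]_(N, k)) : gval L = kerv A ->
  (onframe L).1^t* *m B \in unitmx -> kerv (frame_sec L A B) = colspan B.
Proof.
move=> LA Bu; have Au := kerv_unit LA; have Fc := onframe_complete L.
rewrite /frame_sec; set X := frame_slope L B.
have XB : X *m ((onframe L).1^t* *m B) = (onframe L).2^t* *m B.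
  by rewrite /X /frame_slope mulmxKV.
(* The equation XB determines X, since F1^* B is invertible. *)
clearbody X.
apply/vspaceP => v; rewrite mem_kerv.
apply/eqP/colspanP => [|[x ->]]; last first.
  by rewrite -mulmxA mulmxBl !mulmxA -(mulmxA X) XB subrr mulmx0.
rewrite -mulmxA => /(congr1 (mulmx (invmx (A *m (onframe L).2)))).
rewrite mulKmx // mulmx0 mulmxBl => /eqP; rewrite subr_eq0 => /eqP vX.
set x := invmx ((onframe L).1^t* *m B) *m ((onframe L).1^t* *m v).
have x1 : (onframe L).1^t* *m (B *m x) = (onframe L).1^t* *m v.
  by rewrite mulmxA mulKVmx.
have x2 : (onframe L).2^t* *m (B *m x) = (onframe L).2^t* *m v.
  by rewrite mulmxA -XB -!mulmxA x1 mulmxA vX.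
exists x; rewrite -[LHS]mul1mx -[RHS]mul1mx -Fc !mulmxDl -!mulmxA.
by rewrite x1 x2.
Qed.

End GrassTopology.

(** * Solution maps for subspaces and for kernels *)

Section Transfer.
Variables (R : realType) (n k : nat).
Local Notation C := R[i].
Local Notation P := (projsp R n).
Local Notation grass := (grass R n.+1 k).
Local Notation vecs := ('cV[C]_n.+1 : normedModType C).
Local Notation frames := ('M[C]_(n.+1, k) : normedModType C).
Local Notation M := ('M[C]_(n.+1 - k, n.+1) : normedModType C).
Local Notation charts := ('M[C]_(n.+1 - k, k) : normedModType C).
Implicit Types (x z : P) (L : grass) (A : 'M[C]_(n.+1 - k, n.+1)) (Z : set P).

Lemma rep_neq0 x : rep x != 0.
Proof.
rewrite vpick0 -dimv_eq0; have /eqP -> := gdim x.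
by [].
Qed.

Lemma colspan_line x (v : 'cV[C]_n.+1) : v != 0 -> v \in gval x ->
  colspan v = gval x.
Proof.
move=> v0 vx; have -> : colspan v = <[v]>%VS.
  apply/vspaceP => w; apply/colspanP/vlineP => [[a ->]|[a ->]].
    by exists (a 0 0); rewrite [a in LHS]mx11_scalar mul_mx_scalar.
  by exists a%:M; rewrite mul_mx_scalar.
apply/eqP; rewrite eqEdim -memvE vx dim_vline v0.
by have /eqP -> := gdim x.
Qed.

Lemma pchart_id z : pchart z z = 0.
Proof.
rewrite /pchart divff ?scale1r ?subrr //; apply/eqP => zz.
have /eqP := rep_neq0 z; apply; apply: fnorm_eq0.
rewrite /fnorm mxtrace_mulC /mxtrace big_ord1 -/(hdot (rep z) (rep z)) zz.
by rewrite sqrtr0.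
Qed.

(** Near u = 0 the vector rep z + u is nonzero, so it spans every point x with
pchart z x = u. In particular a point x with rep x orthogonal to rep z, for
which [pchart] divides by zero and has value - rep z, does not occur near 0. *)
Lemma pchart_near z (S : set P) : open S -> S z ->
  \forall u \near (0 : vecs), forall x, pchart z x = u -> S x.
Proof.
move=> [T oT TP] Sz; pose tr (u : 'cV[C]_n.+1) := rep z + u.
have dtr : differentiable tr (0 : vecs).
  by apply: differentiableD; first exact: differentiable_cst.
have ctr := differentiable_continuous dtr.
have T0 : T (tr 0).
  apply/(TP z) => //; rewrite /tr addr0; apply: colspan_line.
    exact: rep_neq0.
  exact: memv_pick.
have n0 : \forall u \near (0 : vecs), tr u != 0.
  by apply: (cvgr_neq0 _ ctr); rewrite /tr addr0 rep_neq0.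
have : \forall u \near (0 : vecs), T (tr u).
  exact: ctr (open_nbhs_nbhs (conj oT T0)).
apply: filter_app; move: n0; apply: filter_app; near=> u => u0 Tu x xu.
apply/(TP x (tr u)) => //; apply: colspan_line => //.
by rewrite /tr -xu /pchart addrCA subrr addr0 memvZ // memv_pick.
Unshelve. all: by end_near. Qed.

(** The default value L is only taken at matrices B without full rank. *)
Definition ker_grass L (B : 'M[C]_(n.+1 - k, n.+1)) : grass :=
  insubd L (kerv B).

Lemma ker_grass_eq L L' B : gval L' = kerv B -> ker_grass L B = L'.
Proof. by move=> LB; rewrite /ker_grass -LB valKd. Qed.

Lemma near_ker_grass L L0 A : gval L = kerv A ->
  \forall B \near (A : M), ker_grass L0 B = gchart L (ker_coord L B) /\
     gval (gchart L (ker_coord L B)) = kerv B.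
Proof.
move=> LA; have := near_solvable (kerv_unit LA).
apply: filterS => B /kerv_gchart BE.
by split; [apply: ker_grass_eq|]; rewrite BE.
Qed.

(** Chain rule for B |-> f (ker B), read in the charts at L and at f L. *)
Lemma differentiable_near_chart (f : grass -> P) (g : M -> P) L A :
  gval L = kerv A -> differentiable (in_charts f L) 0 ->
  (\forall B \near (A : M), g B = f (gchart L (ker_coord L B))) ->
  differentiable (fun X : M => pchart (g A) (g X)) (A : M) /\
  forall H : M, 'd (fun X : M => pchart (g A) (g X)) (A : M) H =
   'd (in_charts f L) 0
     (- (invmx (A *m (onframe L).2) *m (H *m (onframe L).1))).
Proof.
move=> LA df gf; have Au := kerv_unit LA; have A0 := ker_coord0 LA.
have dk : differentiable (ker_coord L : M -> charts) (A : M).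
  exact: differentiable_solve_mx.
have gA : g A = f L by rewrite (nbhs_singleton gf) A0 gchart0.
have gfA : \forall B \near (A : M),
    pchart (g A) (g B) = in_charts f L (ker_coord L B).
  by move: gf; apply: filterS => B ->; rewrite gA.
have [dg dgE] :=
  @near_comp_diff _ M charts vecs _ _ _ (A : M) (0 : charts) A0 dk df gfA.
split=> // H; rewrite dgE; congr ('d _ _ _).
exact: diff_solve_mx (kerv_mul0 LA).
Qed.

(** The neighborhood of A is the set of matrices whose kernel lies in the
neighborhood of L. At each such B the chart at ker B, instead of the one at L,
gives differentiability. *)
Lemma ker_of_solution Z L z A f : gval L = kerv A ->
  is_solution_map Z L z f -> is_ker_solution_map Z A z (f \o ker_grass L).
Proof.
move=> LA [U [V [[oU UL] Vz fU fV]]].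
pose U' := [set B : M | exists2 L', gval L' = kerv B & U L'].
exists U', V; split; [split|exact: Vz| |].
- rewrite openE => B [L' LB UL'].
  have UL'B : \forall X \near (ker_coord L' B : charts), U (gchart L' X).
    by rewrite ker_coord0 //; exact: gchart_near.
  have kc : {for B, continuous (ker_coord L' : M -> charts)}.
    apply: differentiable_continuous; apply: differentiable_solve_mx.
    exact: kerv_unit.
  have nU : \forall B' \near (B : M), U (gchart L' (ker_coord L' B')).
    exact: kc UL'B.
  have nE := near_ker_grass L LB.
  suff : \forall B' \near (B : M), U' B' by [].
  near=> B'; have UB' : U (gchart L' (ker_coord L' B')) by near: B'; exact: nU.
  have [_ BB'] : ker_grass L B' = gchart L' (ker_coord L' B') /\
     gval (gchart L' (ker_coord L' B')) = kerv B' by near: B'; exact: nE.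
  by exists (gchart L' (ker_coord L' B')).
- by exists L; [exact: LA|exact: UL].
- move=> B [L' LB UL'].
  apply: (proj1 (@differentiable_near_chart f (f \o ker_grass L) L' B LB
                   (fU _ UL') _)).
  by move: (near_ker_grass L LB); apply: filterS => B' [/= -> _].
- move=> B [L' LB UL'] /=.
  by rewrite (ker_grass_eq L LB) -(fV _ UL') /points_of LB.
Unshelve. all: by end_near. Qed.

(** The subspace L' is sent to g of the matrix that [frame_sec] attaches to the
chosen frame of L'. This matrix does not depend on the frame, which makes its
domain W open and allows the holomorphic frame F1' + F2' Y to be used near
L'. *)
Lemma solution_of_ker Z L z A g : gval L = kerv A ->
  is_ker_solution_map Z A z g -> exists f, is_solution_map Z L z f.
Proof.
move=> LA [U [V [[oU UA] Vz gU gV]]].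
pose fr (L' : grass) := (onframe L').1.
pose Fu (B : 'M[C]_(n.+1, k)) := (onframe L).1^t* *m B \in unitmx.
pose W := [set L' : grass | Fu (fr L') /\ U (frame_sec L A (fr L'))].
have frE L' (B : 'M[C]_(n.+1, k)) : colspan B = gval L' ->
    Fu B = Fu (fr L') /\ (Fu B -> frame_sec L A B = frame_sec L A (fr L')).
  move=> /frame_change[Q Qu ->].
  have FuQ : Fu (fr L' *m Q) = Fu (fr L').
    by rewrite /Fu mulmxA unitmx_mul Qu andbT.
  split; first exact: FuQ.
  by rewrite FuQ => Fu'; exact: frame_sec_mulmx.
have frL L' : colspan (fr L') = gval L' by have [] := onframeP L'.
have Fu_near (T : normedModType C) (B : T -> 'M[C]_(n.+1, k)) (t0 : T) :
    differentiable B t0 -> Fu (B t0) -> \forall t \near t0, Fu (B t).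
  move=> dB; apply: (@near_unitmx _ _ t0 _ (fun t => (onframe L).1^t* *m B t)).
  exact: differentiable_mulmxl.
exists (fun L' => g (frame_sec L A (fr L'))), W, V.
split; [split|exact: Vz| |].
- exists [set B : frames | Fu B /\ U (frame_sec L A B)].
    rewrite openE => B [FuB UB]; apply: filterI.
      exact: (Fu_near frames id).
    have ds : differentiable (fun B : frames => frame_sec L A B : M) B.
      exact: (@differentiable_frame_sec _ _ _ frames _ _ _ id).
    exact: (differentiable_continuous ds) (open_nbhs_nbhs (conj oU UB)).
  move=> L' B /frE [FuB secB]; rewrite /W /=.
  rewrite -FuB; split=> -[h1 h2]; (split; first exact: h1).
    by rewrite (secB h1); exact: h2.
  by rewrite -(secB h1); exact: h2.
- have [F11 _ _ _] := onframeP L.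
  by split; [rewrite /Fu F11 unitmx1|rewrite (frame_sec0 LA); exact: UA].
- move=> L' [FuL' UL'].
  pose B (Y : charts) : frames := (onframe L').1 + (onframe L').2 *m Y.
  have B0 : B 0 = fr L' by rewrite /B mulmx0 addr0.
  have dB : differentiable B (0 : charts).
    apply: differentiableD; first exact: differentiable_cst.
    exact: differentiable_mulmxl.
  have FuB0 : Fu (B 0) by rewrite B0.
  have dS :
      differentiable (fun Y : charts => frame_sec L A (B Y) : M) (0 : charts).
    exact: differentiable_frame_sec.
  have S0 : frame_sec L A (B 0) = frame_sec L A (fr L') by rewrite B0.
  apply: (proj1 (@near_comp_diff _ charts M vecs _ _ _ _ _ S0 dS (gU _ UL') _)).
  have := Fu_near _ _ _ dB FuB0; apply: filterS => Y FuY; rewrite /in_charts.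
  have [_ /(_ FuY) ->] := frE (gchart L' Y) (B Y) (esym (gchart_val L' Y)).
  by [].
- move=> L' [FuL' UL']; rewrite -(gV _ UL') /points_of kerv_frame_sec // frL.
  by [].
Qed.

(** Near A the point f (ker B) lies in Z, on ker B and, as f (ker B) tends to
f L = z, in any neighborhood of z; the defining property of g leaves no point
but g B. *)
Lemma solution_maps_agree Z L z A f g : Z z -> (gval z <= gval L)%VS ->
  gval L = kerv A -> is_solution_map Z L z f -> is_ker_solution_map Z A z g ->
  \forall B \near (A : M), g B = f (gchart L (ker_coord L B)).
Proof.
move=> Zz zL LA [U [V [[oU UL] [Vz [S oS VS]] fU fV]]].
move=> [U' [V' [[oU' UA] [V'z [S' oS' VS']] gU gV]]].
have fL : f L = z.
  have : (points_of L `&` V) z by [].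
  by rewrite (fV _ UL) => ->.
pose h := (fun B : M => in_charts f L (ker_coord L B)).
have Au := kerv_unit LA; have A0 := ker_coord0 LA.
have dk : differentiable (ker_coord L : M -> charts) (A : M).
  exact: differentiable_solve_mx.
have hE : \forall B \near (A : M), h B = in_charts f L (ker_coord L B).
  by near=> B; exact: erefl.
have [dh _] :=
  @near_comp_diff _ M charts vecs _ _ h (A : M) (0 : charts) A0 dk
    (fU _ UL) hE.
have h0 : h A = 0 by rewrite /h A0 /in_charts gchart0 pchart_id.
have S'z : S' z by move: V'z; rewrite VS' => -[].
have nS' : \forall B \near (A : M), S' (f (gchart L (ker_coord L B))).
  have nh0 : \forall u \near (h A : vecs), forall x, pchart z x = u -> S' x.
    by rewrite h0; exact: pchart_near.
  have nh : \forall B \near (A : M), forall x, pchart z x = h B -> S' x.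
    exact: (differentiable_continuous dh) nh0.
  by near=> B; apply: (near nh B) => //; rewrite /h /in_charts fL.
have nU : \forall B \near (A : M), U (gchart L (ker_coord L B)).
  have nU0 : \forall X \near (ker_coord L A : charts), U (gchart L X).
    by rewrite A0; exact: (gchart_near oU UL).
  exact: (differentiable_continuous dk) nU0.
have nU' : \forall B \near (A : M), U' B by exact: open_nbhs_nbhs.
have nE := near_ker_grass L LA.
near=> B.
have UB : U (gchart L (ker_coord L B)) by near: B; exact: nU.
have U'B : U' B by near: B; exact: nU'.
have S'B : S' (f (gchart L (ker_coord L B))) by near: B; exact: nS'.
have [_ EB] : ker_grass L B = gchart L (ker_coord L B) /\
     gval (gchart L (ker_coord L B)) = kerv B by near: B; exact: nE.
have : (points_of (gchart L (ker_coord L B)) `&` V)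
    (f (gchart L (ker_coord L B))).
  by rewrite (fV _ UB).
rewrite VS => -[ptB [ZB _]].
have : (points_of (kerv B) `&` V') (f (gchart L (ker_coord L B))).
  by rewrite VS' -EB.
by rewrite (gV _ U'B) => ->.
Unshelve. all: by end_near. Qed.

End Transfer.

(** * Comparison of the condition numbers *)

Section Compare.
Variables (R : realType) (n k : nat).
Local Notation C := R[i].
Local Notation P := (projsp R n).
Local Notation grass := (grass R n.+1 k).
Local Notation M := ('M[C]_(n.+1 - k, n.+1) : normedModType C).

(** If no solution map exists, both sides are differentials of constant maps. *)
Lemma diff_solution_maps (Z : set P) (L : grass) (z : P)
    (A : 'M[C]_(n.+1 - k, n.+1)) :
  Z z -> (gval z <= gval L)%VS -> gval L = kerv A ->
  let G := ker_solution_map Z A z in let gamma := solution_map Z L z in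
  forall H : M, 'd (fun X : M => pchart (G A) (G X)) (A : M) H =
    'd (in_charts gamma L) 0
      (- (invmx (A *m (onframe L).2) *m (H *m (onframe L).1))).
Proof.
move=> Zz zL LA G gamma; rewrite {}/G {}/gamma.
have [[f fP]|noL] := pselect (exists f, is_solution_map Z L z f).
  have fS : is_solution_map Z L z (solution_map Z L z).
    by apply: (@xgetPex _ _ [set f | is_solution_map Z L z f]); exists f.
  have gS : is_ker_solution_map Z A z (ker_solution_map Z A z).
    apply: (@xgetPex _ _ [set g | is_ker_solution_map Z A z g]).
    by exists (f \o ker_grass L); exact: ker_of_solution.
  have gf := solution_maps_agree Zz zL LA fS gS.
  have df : differentiable (in_charts (solution_map Z L z) L) 0.
    by have [U [V [[_ UL] _ dU _]]] := fS; exact: dU.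
  by have [] := differentiable_near_chart LA df gf.
have fE : solution_map Z L z = fun=> z.
  rewrite /solution_map; case: xgetP => // f _ fP.
  by case: noL; exists f.
have gE : ker_solution_map Z A z = fun=> z.
  rewrite /ker_solution_map; case: xgetP => // g _ gP.
  by case: noL; exact: solution_of_ker LA gP.
move=> H; rewrite gE fE.
rewrite (_ : in_charts _ _ = cst (pchart z z)); last by apply/funext.
by rewrite !diff_cst.
Qed.

Hypotheses (k_gt0 : (0 < k)%N) (k_lt : (0 < n.+1 - k)%N).

Lemma kappa_kercond_le (Z : set P) (L : grass) (z : P)
    (A : 'M[C]_(n.+1 - k, n.+1)) :
  \rank A = (n.+1 - k)%N -> gval L = kerv A -> Z z -> (gval z <= gval L)%VS ->
  (kappa Z L z <= kercond Z A z)%E /\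
  (kercond Z A z <= cond A * kappa Z L z)%E.
Proof.
move=> rA LA Zz zL; have Au := kerv_unit LA.
have [F11 F22 F21 _] := onframeP L.
have mpE := mpinv_kerv LA.
have A0 : A != 0.
  by apply: contraTneq k_lt => A0; rewrite -rA A0 mxrank0.
have mp0 : mpinv A != 0.
  apply: contraNneq A0 => mp0; rewrite -[A]mul1mx.
  by rewrite -(mulmxV Au) -(mulmxA A) -mpE mp0 mulmx0 mul0mx.
have sA := spec_norm_gt0 A0; have smp := spec_norm_gt0 mp0.
rewrite /kappa /kercond -LA.
have andTp (p q : Prop) : p -> `[< p /\ q >] = `[< q >].
  by move=> hp; apply/asboolP/asboolP => [[]|].
rewrite (andTp _ _ rA).
(* When kappa = kercond = +oo, cond A > 0 is needed for cond A * +oo = +oo. *)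
case: asboolP => _; last first.
  by split; rewrite ?leey // gt0_muley ?mule_gt0.
set D := 'd _ 0; set E := 'd _ (A : M).
have ED H : E H = D (- (invmx (A *m (onframe L).2) *m (H *m (onframe L).1))).
  exact: diff_solution_maps.
have DZ (r : R) X : D (r%:C *: X) = r%:C *: D X by rewrite linearZ.
have EZ (r : R) X : E (r%:C *: X) = r%:C *: E X by rewrite linearZ.
have D0 := opnorm_ge0 D (fnorm_ge0 (rep z)) k_lt k_gt0.
have E0 := opnorm_ge0 E (fnorm_ge0 (rep z)) k_lt (ltn0Sn n).
split.
  apply: ge_ereal_sup => _ [X X1 <-].
  (* A preimage of X under H |-> - (A F2)^-1 (H F1). *)
  pose H := - (A *m ((onframe L).2 *m (X *m (onframe L).1^t*))).
  have -> : D X = E H.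
    rewrite ED; congr (D _); rewrite /H mulNmx mulmxN opprK.
    by rewrite -!mulmxA F11 mulmx1 (mulmxA A) mulKmx.
  apply: (le_trans (opnorm_ub (fnorm (rep z)) EZ H)).
  apply: lee_wpmul2r => //; rewrite fnormN; apply: spec_norm_ub => //.
  by rewrite fnorm_isol // fnorm_isor // X1.
rewrite /cond -muleA; apply: lee_wpmul2l; first exact: ltW.
apply: ge_ereal_sup => _ [H H1 <-]; rewrite ED.
apply: (le_trans (opnorm_ub (fnorm (rep z)) DZ _)).
apply: lee_wpmul2r => //; rewrite fnormN -(fnorm_isol _ F22) mulmxA -mpE.
apply: spec_norm_ub => //; rewrite -H1; exact: fnorm_onframe_le.
Qed.

End Compare.

Theorem theorem1p3 (R : realType) (n m s : nat)
    (m_gt0 : (0 < m)%N) (m_lt_n : (m < n)%N) (s_def : s = (n - m)%N)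
    (Z : set (projsp R n)) (Z_var : irr_variety Z) (Z_dim : has_dim Z m)
    (A : 'M[R[i]%C]_(m, n.+1)) (A_full : \rank A = m)
    (L : grass R n.+1 s.+1) (L_ker : gval L = kerv A)
    (z : projsp R n) (zZ : Z z) (zL : (gval z <= gval L)%VS) :
  (kappa Z L z <= kercond Z A z)%E /\
  (kercond Z A z <= cond A * kappa Z L z)%E.
Proof.
(* In the charts at L, matrices have n.+1 - s.+1 rows: m is written this way. *)
have mE : m = (n.+1 - s.+1)%N by rewrite subSS s_def subKn // ltnW.
clear s_def Z_var Z_dim m_lt_n; move: m_gt0 A A_full L_ker; rewrite {}mE.
move=> m_gt0 A A_full L_ker.
exact: kappa_kercond_le.
Qed.
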